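(* Let $a<b$, $K\ge2$, $\mathcal{I}=\{1,\dots,K\}$, $\mathscr{D}\subseteq D_{cdf}([a,b])$ nonempty and convex, and $\mathsf{T}:D_{cdf}([a,b])\to\mathbb{R}$ with $|\mathsf{T}(F)-\mathsf{T}(G)|\le C\|F-G\|_\infty$ for all $F\in\mathscr{D}$, $G\in D_{cdf}([a,b])$, some $C>0$. Suppose $\mathscr{D}$ contains $H_1,H_2$ with $J_\tau:=\tau H_1+(1-\tau)H_2\in\mathscr{D}$ for all $\tau\in[0,1]$ and $\mathsf{T}(J_{\tau_2})-\mathsf{T}(J_{\tau_1})\ge c_-(\tau_2-\tau_1)$ for all $0\le\tau_1\le\tau_2\le1$, some $c_->0$. Let $\mathscr{M}_K\subseteq\mathscr{S}_K$ be closed with at least two elements. Then there exists $c>0$, independent of $K$, $n$ and $\mathscr{M}_K$, such that for every policy $\pi$ with recommendations in $\mathscr{M}_K$ and every randomization measure $\mathbb{P}_G$, $$\sup_{F^1,\dots,F^K\in\{J_\tau:\tau\in[0,1]\}}\mathbb{E}[r_n(\pi,\mathscr{M}_K)]\ge c\max_{\mathcal{H}}\kappa(\mathcal{H},\mathscr{M}_K)\sqrt{|\mathcal{H}|/n}\quad\text{for every }n\ge K,$$ where the maximum is over all partitions $\mathcal{H}$ of $\{1,\dots,K\}$, $|\mathcal{H}|$ is the number of blocks, and the supremum is over potential outcome distributions with independent marginals having cdfs in $\{J_\tau:\tau\in[0,1]\}$.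
   Context: $D_{cdf}([a,b])$: cdfs with $F(a-)=0$, $F(b)=1$; $\mathscr{S}_K$ unit simplex; $\langle\delta,\mathbf{F}\rangle=\sum_i\delta_iF^i$. For a partition $\mathcal{H}=\{\mathcal{H}_1,\dots,\mathcal{H}_l\}$ of $\{1,\dots,K\}$, $B_i$ is the $K\times|\mathcal{H}_i|$ matrix with columns the standard basis vectors $e_j(K)$, $j\in\mathcal{H}_i$, and $\kappa(\mathcal{H},\mathscr{M}_K)=\sup\{[\max_{\delta\in\mathscr{M}_K}v'\delta-\sup_{\delta\in\mathscr{T}}v'\delta]\wedge\min_{i\le l}[\max_{\delta\in\mathscr{M}_K}(v+B_iw_i)'\delta-\sup_{\delta\in\mathscr{M}_K\setminus\mathscr{T}}(v+B_iw_i)'\delta]\}$ over nonempty Borel $\mathscr{T}\subsetneq\mathscr{M}_K$, $v\in[-1,1]^K$, $w_i\in[-1,1]^{|\mathcal{H}_i|}$. Setting: $Y_t=(Y_{1,t},\dots,Y_{K,t})$ i.i.d. over $t$, $Y_{i,t}\sim F^i$; $G_t$ i.i.d. with law $\mathbb{P}_G$, independent of $(Y_t)$. A policy with recommendations in $\mathscr{M}_K$: for each $n\ge K$, measurable $\pi_{n,t}:([a,b]\times\mathbb{R})^{t-1}\times\mathbb{R}\to\mathcal{I}$ ($t\le n$), $\pi_{n,n+1}:([a,b]\times\mathbb{R})^n\times\mathbb{R}\to\mathscr{M}_K$, with inputs $(Z_0,G_1)=(G_1)$, $Z_{t-1}=(Y_{\pi_{n,t-1}(Z_{t-2},G_{t-1}),t-1},G_{t-1},\dots,Y_{\pi_{n,1}(G_1),1},G_1)$.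 Regret $r_n(\pi,\mathscr{M}_K)=\max_{\delta\in\mathscr{M}_K}\mathsf{T}(\langle\delta,\mathbf{F}\rangle)-\mathsf{T}(\langle\pi_{n,n+1}(Z_n,G_{n+1}),\mathbf{F}\rangle)$. *)

(* Defs.v *)
From HB Require Import structures.
From mathcomp Require Import all_boot all_order all_algebra.
From mathcomp Require Import all_classical all_reals all_analysis.
Set Implicit Arguments. Unset Strict Implicit. Unset Printing Implicit Defensive.
Import Order.TTheory GRing.Theory Num.Theory.
Import numFieldNormedType.Exports.
Local Open Scope classical_set_scope.
Local Open Scope ring_scope.

Section Defs.
Variable R : realType.

Definition is_cdf_ab (a b : R) (F : R -> R) : Prop :=
  [/\ {homo F : x y / x <= y},
      (forall x : R, F y @[y --> x^'+] --> F x),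
      F x @[x --> -oo] --> (0 : R) &
      F x @[x --> +oo] --> (1 : R)] /\
  (F x @[x --> a^'-] --> (0 : R) /\ F b = 1).

Definition supnorm (f : R -> R) : \bar R :=
  ereal_sup [set (`|f x|)%:E | x in [set: R]].

Definition Jmix (H1 H2 : R -> R) (tau : R) : R -> R :=
  fun x => tau * H1 x + (1 - tau) * H2 x.

Definition simplex (K : nat) : set 'rV[R]_K :=
  [set d | (forall i, 0 <= d 0 i) /\ \sum_(i < K) d 0 i = 1].

Definition mixcdf (K : nat) (d : 'rV[R]_K) (F : 'I_K -> R -> R) : R -> R :=
  fun x => \sum_(i < K) d 0 i * F i x.

Definition dotv (K : nat) (v : 'I_K -> R) (d : 'rV[R]_K) : R :=
  \sum_(i < K) v i * d 0 i.

Definition supdot (K : nat) (S : set 'rV[R]_K) (v : 'I_K -> R) : \bar R :=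
  ereal_sup [set (dotv v d)%:E | d in S].

(* v + B_i w_i, where w_i is given by its entries w B j, j in the block B *)
Definition addB (K : nat) (v : 'I_K -> R) (B : {set 'I_K}) (wB : 'I_K -> R)
  : 'I_K -> R := fun j => v j + (if j \in B then wB j else 0).

Definition kappa (K : nat) (M : set 'rV[R]_K) (P : {set {set 'I_K}}) : \bar R :=
  ereal_sup [set e | exists (T : set 'rV[R]_K) (v : 'I_K -> R)
                            (w : {set 'I_K} -> 'I_K -> R),
     [/\ T !=set0, T `<` M & (<<s [set A : set 'rV[R]_K | open A] >>) T] /\
     [/\ (forall j, -1 <= v j <= 1),
         (forall B, B \in P -> forall j, j \in B -> -1 <= w B j <= 1) &
         e = (mine (supdot M v - supdot T v)
                  (\big[mine/+oo]_(B in P)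
                      (supdot M (addB v B (w B)) - supdot (M `\` T) (addB v B (w B)))))%E]].

(* histories Z_t (newest first) with outcomes in [a,b] *)
Definition hdom (a b : R) (t : nat) : set (t.-tuple (R * R)) :=
  [set h | forall j, a <= (tnth h j).1 <= b].

(* A policy with recommendations in M: for each n >= K,
   pol n t h g  = pi_{n,t+1}(Z_t, G_{t+1})  for t < n (h = Z_t has t entries),
   rec n h g    = pi_{n,n+1}(Z_n, G_{n+1}). *)
Definition is_policy (a b : R) (K : nat) (M : set 'rV[R]_K)
  (pol : nat -> nat -> seq (R * R) -> R -> 'I_K)
  (rec : nat -> seq (R * R) -> R -> 'rV[R]_K) : Prop :=
  forall n, (K <= n)%N ->
    [/\ (forall t, (t < n)%N -> forall i : 'I_K,
           measurable ((@hdom a b t `*` [set: R]) `&`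
                       [set p | pol n t (tval p.1) p.2 = i])),
        (forall B : set 'rV[R]_K, (<<s [set A : set 'rV[R]_K | open A] >>) B ->
           measurable ((@hdom a b n `*` [set: R]) `&`
                       [set p | B (rec n (tval p.1) p.2)])) &
        (forall (h : n.-tuple (R * R)) g, @hdom a b n h -> M (rec n (tval h) g))].

Definition regret (T : (R -> R) -> R) (K : nat) (M : set 'rV[R]_K)
  (F : 'I_K -> R -> R) (d : 'rV[R]_K) : \bar R :=
  (ereal_sup [set (T (mixcdf d' F))%:E | d' in M] - (T (mixcdf d F))%:E)%E.

(* Expectation under the sequential sampling model: at each round a fresh
   G ~ PG is drawn, the arm pol(size h) h G is chosen and its outcome
   Y ~ mu_arm is observed (Y_t i.i.d. with independent marginals mu_i,
   independent of the G_t); finally G_{n+1} ~ PG is drawn and f is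
   evaluated.  [ev k h] is the conditional expectation given history h with
   k rounds remaining. *)
Fixpoint ev (K : nat) (mu : 'I_K -> probability R R) (PG : probability R R)
  (pol : nat -> seq (R * R) -> R -> 'I_K) (f : seq (R * R) -> R -> \bar R)
  (k : nat) (h : seq (R * R)) : \bar R :=
  match k with
  | 0 => (\int[PG]_g f h g)%E
  | k'.+1 => (\int[PG]_g \int[mu (pol (size h) h g)]_y
                ev mu PG pol f k' ((y, g) :: h))%E
  end.

(* E[r_n(pi, M_K)] for marginal laws mu_i with cdfs F^i *)
Definition exp_regret (T : (R -> R) -> R) (K : nat) (M : set 'rV[R]_K)
  (pol : nat -> nat -> seq (R * R) -> R -> 'I_K)
  (rec : nat -> seq (R * R) -> R -> 'rV[R]_K)
  (PG : probability R R) (n : nat)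
  (F : 'I_K -> R -> R) (mu : 'I_K -> probability R R) : \bar R :=
  ev mu PG (pol n) (fun h g => regret T M F (rec n h g)) n [::].

End Defs.

(* Main.v *)
(* Along the segment the regret of a recommendation d is at least cminus times
   the linear gap max (tau . d') - tau . d.  For a block B of a partition with l
   blocks compare tau0 = 1/2 + s v with tauB = 1/2 + s (v + B w_B), where
   s = sqrt (l / n) / 8: a recommendation in the set T costs at least
   cminus s e under tau0, one outside T costs that much under tauB, where e is
   the value of the expression maximised in kappa.  An outcome with law J_tau is
   a draw from H1 or H2 selected by a Bernoulli(tau) coin, so the two experiments
   have divergence at most 6 s^2 E_0[number of pulls in B].  Integrating
   min(p,q) >= p/2 + p ln(q/p) - (q - p) over the likelihoods gives, for every
   block, E_0 + E_B >= cminus s e (1/2 - 6 s^2 E_0[pulls in B]); the pulls add up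
   to n over the blocks, and averaging over them leaves a constant fraction of
   cminus s e.  Everything is done by induction on the number of remaining rounds
   in [ev], so no measure on histories is needed. *)
Require Import Defs.
From HB Require Import structures.
From mathcomp Require Import all_boot all_order all_algebra.
From mathcomp Require Import all_classical all_reals all_analysis.
From mathcomp Require Import measurable_realfun ring lra.
Import Order.TTheory GRing.Theory Num.Theory.
Import numFieldNormedType.Exports.
Local Open Scope classical_set_scope.
Local Open Scope ring_scope.

Set Implicit Arguments.
Unset Strict Implicit.
Unset Printing Implicit Defensive.

(** * Integration against probability measures *)

Section integral_extra.
Context {d : measure_display} {T : measurableType d} {R : realType}.
Local Open Scope ereal_scope.

Import HBNNSimple.

(** The integral is a supremum over the simple functions below [f], measurable or not. Cutting such
    a simple function down to [A] keeps its integral, since the complement of [A] is null. *)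
Let ge0_integral_conull (mu : {measure set T -> \bar R}) (A : set T)
    (f : T -> \bar R) :
  measurable A -> mu (~` A) = 0 -> (forall x, 0 <= f x) ->
  \int[mu]_x f x = \int[mu]_(x in A) f x.
Proof.
move=> mA muA f0.
have fA0 x : 0 <= (f \_ A) x by rewrite patchE; case: ifP.
rewrite (integral_mkcond A) !ge0_integralTE//.
apply/eqP; rewrite eq_le; apply/andP; split.
- apply: ge_ereal_sup => _ [h /= hf <-].
  apply: ereal_sup_ubound => /=; exists (proj_nnsfun h mA) => /=.
    move=> x; have /= <- := congr1 (@^~ x) (mrestrict h mA).
    by rewrite !patchE; case: ifP.
  rewrite -mrestrict -(integral_nnsfun mu mA h) -integralT_nnsfun.
  rewrite [RHS](ge0_negligible_integral (N := ~` A))//.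
  + by rewrite setTD setCK.
  + exact: measurableC.
  + by apply/measurable_EFinP.
  + by move=> x _; rewrite lee_fin.
- apply: ge_ereal_sup => _ [h /= hf <-].
  apply: ereal_sup_ubound => /=; exists h => //= x.
  by apply: le_trans (hf x) _; rewrite patchE; case: ifP.
Qed.

(* Unlike [negligible_integral], this does not require [f] to be measurable. *)
Lemma integral_conull (mu : {measure set T -> \bar R}) (A : set T)
    (f : T -> \bar R) :
  measurable A -> mu (~` A) = 0 ->
  \int[mu]_x f x = \int[mu]_(x in A) f x.
Proof.
move=> mA muA; rewrite integralE [RHS]integralE.
by congr (_ - _); apply: ge0_integral_conull.
Qed.

(** The bound is allowed to be negative, as the likelihood bound [Phi] below can be. *)
Lemma le_cst_integral (P : probability T R) (c : R) (f : T -> \bar R) :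
  measurable_fun setT f -> (forall x, 0 <= f x) -> (forall x, c%:E <= f x) ->
  c%:E <= \int[P]_x f x.
Proof.
move=> mf f0 cf; have [c0|c0] := leP c 0%R.
  by apply: le_trans (integral_ge0 _ _) => //; rewrite lee_fin.
have <- : \int[P]_x (cst c%:E x) = c%:E.
  by rewrite integral_cst//= probability_setT mule1.
by apply: ge0_le_integral => // x _; rewrite lee_fin ltW.
Qed.

(** Used wherever both environments draw from the same law: a bound that holds for each realisation
    survives integration on the two sides. *)
Lemma le_lincomb_integral (P : probability T R) (c p q : R) (f g : T -> \bar R) :
  (0 <= p)%R -> (0 <= q)%R ->
  measurable_fun setT f -> measurable_fun setT g ->
  (forall x, 0 <= f x) -> (forall x, 0 <= g x) ->
  (forall x, c%:E <= p%:E * f x + q%:E * g x) ->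
  c%:E <= p%:E * \int[P]_x f x + q%:E * \int[P]_x g x.
Proof.
move=> p0 q0 mf mg f0 g0 cfg.
have mpf : measurable_fun setT (fun x => p%:E * f x).
  by apply: emeasurable_funM => //; exact: measurable_cst.
have mqg : measurable_fun setT (fun x => q%:E * g x).
  by apply: emeasurable_funM => //; exact: measurable_cst.
have pf0 x : 0 <= p%:E * f x by rewrite mule_ge0.
have qg0 x : 0 <= q%:E * g x by rewrite mule_ge0.
rewrite -!ge0_integralZl_EFin// -ge0_integralD//.
by apply: le_cst_integral => //; [exact: emeasurable_funD|move=> x; exact: adde_ge0].
Qed.

(** The selected function is a finite sum of indicators times the [G i]. Here [sel] is the pulled
    arm, which determines the law of the next outcome. *)
Lemma measurable_fun_fin_cases (I : finType) (sel : T -> I)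
    (G : I -> T -> \bar R) :
  (forall i, measurable [set x | sel x = i]) ->
  (forall i, measurable_fun setT (G i)) ->
  measurable_fun setT (fun x => G (sel x) x).
Proof.
move=> msel mG.
have -> : (fun x => G (sel x) x) =
    (fun x => \sum_(i <- enum I) (\1_[set x | sel x = i] x : R)%:E * G i x).
  apply/funext => x; rewrite big_enum /= (bigD1 (sel x))//= big1 ?adde0.
    by rewrite indicE mem_set// mul1e.
  by move=> i /negP ix; rewrite indicE memNset ?mul0e// => /= /esym /eqP.
apply: emeasurable_sum => i; apply: emeasurable_funM => //.
exact/measurable_EFinP/measurable_indic.
Qed.

End integral_extra.

(** * Measurability and linearity of the sequential expectation [ev] *)

Section measurable_ev.
Variables (R : realType) (K n : nat) (PG : probability R R).
Variable pol : nat -> seq (R * R) -> R -> 'I_K.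
Hypothesis mpol : forall t, (t < n)%N -> forall i,
  measurable [set p : t.-tuple (R * R) * R | pol t p.1 p.2 = i].
Local Open Scope ereal_scope.

(** Measurability concerns histories of full length [n] only: [ev] evaluates its payoff after the
    last round. *)
Definition measurable_payoff (f : seq (R * R) -> R -> \bar R) :=
  measurable_fun setT (fun p : n.-tuple (R * R) * R => f p.1 p.2) /\
  (forall h g, 0 <= f h g).

Lemma ev_ge0 (mu : 'I_K -> probability R R) f k h :
  (forall h g, 0 <= f h g) -> 0 <= ev mu PG pol f k h.
Proof.
move=> f0; elim: k h => [|k IH] h /=; first exact: integral_ge0.
by apply: integral_ge0 => g _; apply: integral_ge0 => y _.
Qed.

Lemma measurable_cons_pair t (G : seq (R * R) -> \bar R) :
  measurable_fun setT (fun h : t.+1.-tuple (R * R) => G h) ->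
  measurable_fun setT
    (fun z : (t.-tuple (R * R) * R) * R => G ((z.2, z.1.2) :: z.1.1)).
Proof.
move=> mG.
pose c (z : (t.-tuple (R * R) * R) * R) : t.+1.-tuple (R * R) :=
  [the t.+1.-tuple (R * R) of (z.2, z.1.2) :: z.1.1].
rewrite (_ : (fun z => _) = (fun h : t.+1.-tuple (R * R) => G h) \o c)//.
apply: measurableT_comp => //.
apply: measurable_cons.
  by apply/measurable_fun_pair => //; exact: measurableT_comp.
exact: measurableT_comp.
Qed.

Lemma measurable_step t (m : probability R R) (G : seq (R * R) -> \bar R) :
  (forall h, 0 <= G h) ->
  measurable_fun setT (fun h : t.+1.-tuple (R * R) => G h) ->
  measurable_fun setT
    (fun p : t.-tuple (R * R) * R => \int[m]_y G ((y, p.2) :: p.1)).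
Proof.
move=> G0 /measurable_cons_pair mG.
exact: (measurable_fun_fubini_tonelli_F (m2 := m) _ mG).
Qed.

Lemma measurable_step_pol t (mu : 'I_K -> probability R R)
    (G : seq (R * R) -> \bar R) : (t < n)%N ->
  (forall h, 0 <= G h) ->
  measurable_fun setT (fun h : t.+1.-tuple (R * R) => G h) ->
  measurable_fun setT (fun p : t.-tuple (R * R) * R =>
    \int[mu (pol (size p.1) p.1 p.2)]_y G ((y, p.2) :: p.1)).
Proof.
move=> tn G0 mG.
under eq_fun do rewrite size_tuple.
pose F (i : 'I_K) (p : t.-tuple (R * R) * R) := \int[mu i]_y G ((y, p.2) :: p.1).
have mF i : measurable_fun setT (F i) by exact: measurable_step.
exact: (measurable_fun_fin_cases (mpol tn) mF).
Qed.

Lemma measurable_ev (mu : 'I_K -> probability R R) f k t :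
  measurable_payoff f -> (t + k = n)%N ->
  measurable_fun setT (fun h : t.-tuple (R * R) => ev mu PG pol f k h).
Proof.
move=> [mf f0]; elim: k t => [|k IH] t.
  rewrite addn0 => ->.
  exact: (measurable_fun_fubini_tonelli_F (m2 := PG) _ mf).
move=> tkn; have tn : (t < n)%N by rewrite -tkn addnS ltnS leq_addr.
have /IH mG : (t.+1 + k = n)%N by rewrite addSnnS.
have := @measurable_step_pol t mu (ev mu PG pol f k) tn
  (fun h => @ev_ge0 mu f k h f0) mG.
move/(measurable_fun_fubini_tonelli_F (m2 := PG)); apply => p.
by apply: integral_ge0 => y _; exact: ev_ge0.
Qed.

Lemma measurable_ev_inner (mu : 'I_K -> probability R R) f k t
    (h : t.-tuple (R * R)) :
  measurable_payoff f -> (t + k.+1 = n)%N ->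
  measurable_fun setT (fun g =>
    \int[mu (pol (size h) h g)]_y ev mu PG pol f k ((y, g) :: h)).
Proof.
move=> pf tkn; have tn : (t < n)%N by rewrite -tkn addnS ltnS leq_addr.
have mG : measurable_fun setT (fun h : t.+1.-tuple (R * R) => ev mu PG pol f k h).
  by apply: measurable_ev => //; rewrite addSnnS.
have := @measurable_step_pol t mu (ev mu PG pol f k) tn
  (fun h => @ev_ge0 mu f k h pf.2) mG.
exact: measurable_fun_pair2.
Qed.

Lemma measurable_ev_cons (mu : 'I_K -> probability R R) f k t
    (h : t.-tuple (R * R)) g :
  measurable_payoff f -> (t + k.+1 = n)%N ->
  measurable_fun setT (fun y => ev mu PG pol f k ((y, g) :: h)).
Proof.
move=> pf tkn.
have mG : measurable_fun setT (fun h : t.+1.-tuple (R * R) => ev mu PG pol f k h).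
  by apply: measurable_ev => //; rewrite addSnnS.
have := measurable_cons_pair mG.
by move/(measurable_fun_pair2 (h, g)).
Qed.

Lemma measurable_payoff_section f (h : n.-tuple (R * R)) :
  measurable_payoff f -> measurable_fun setT (f h).
Proof. by move=> [mf _]; exact: (measurable_fun_pair2 h mf). Qed.

Lemma measurable_payoffD f1 f2 :
  measurable_payoff f1 -> measurable_payoff f2 ->
  measurable_payoff (fun h g => f1 h g + f2 h g).
Proof.
move=> [m1 p1] [m2 p2]; split; first exact: emeasurable_funD.
by move=> h g; exact: adde_ge0.
Qed.

Lemma evD (mu : 'I_K -> probability R R) f1 f2 k t (h : t.-tuple (R * R)) :
  measurable_payoff f1 -> measurable_payoff f2 -> (t + k = n)%N ->
  ev mu PG pol (fun h g => f1 h g + f2 h g) k h =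
  ev mu PG pol f1 k h + ev mu PG pol f2 k h.
Proof.
move=> pf1 pf2; elim: k t h => [|k IH] t h tkn /=.
  have tn : t = n by rewrite -tkn addn0.
  subst t; rewrite ge0_integralD//.
  - by move=> *; apply: pf1.2.
  - exact: measurable_payoff_section.
  - by move=> *; apply: pf2.2.
  - exact: measurable_payoff_section.
rewrite -ge0_integralD//.
- apply: eq_integral => g _; rewrite -ge0_integralD//.
  + apply: eq_integral => y _.
    by apply: (IH t.+1 [the t.+1.-tuple _ of (y, g) :: h]); rewrite addSnnS.
  + by move=> y _; apply/ev_ge0/pf1.2.
  + exact: measurable_ev_cons.
  + by move=> y _; apply/ev_ge0/pf2.2.
  + exact: measurable_ev_cons.
- by move=> g _; apply: integral_ge0 => y _; apply/ev_ge0/pf1.2.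
- exact: measurable_ev_inner.
- by move=> g _; apply: integral_ge0 => y _; apply/ev_ge0/pf2.2.
- exact: measurable_ev_inner.
Qed.

Lemma eq_ev (mu : 'I_K -> probability R R)
    (f1 f2 : seq (R * R) -> R -> \bar R) k t (h : t.-tuple (R * R)) :
  (forall (h : n.-tuple (R * R)) g, f1 h g = f2 h g) -> (t + k = n)%N ->
  ev mu PG pol f1 k h = ev mu PG pol f2 k h.
Proof.
move=> f12; elim: k t h => [|k IH] t h tkn /=.
  have tn : t = n by rewrite -tkn addn0.
  by subst t; apply: eq_integral => g _; rewrite f12.
apply: eq_integral => g _; apply: eq_integral => y _.
by apply: (IH t.+1 [the t.+1.-tuple _ of (y, g) :: h]); rewrite addSnnS.
Qed.

Lemma ev_cst (mu : 'I_K -> probability R R) (c : \bar R) k h :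
  ev mu PG pol (fun _ _ => c) k h = c.
Proof.
have Pc (P : probability R R) : \int[P]_x (cst c x) = c.
  by rewrite integral_cst//= probability_setT mule1.
elim: k h => [|k IH] h /=; first exact: Pc.
rewrite -[RHS](Pc PG); apply: eq_integral => g _.
rewrite /= -[RHS](Pc (mu (pol (size h) h g))).
by apply: eq_integral => y _; rewrite IH.
Qed.

Lemma measurable_payoff_sum (I : Type) (s : seq I)
    (f : I -> seq (R * R) -> R -> \bar R) :
  (forall i, measurable_payoff (f i)) ->
  measurable_payoff (fun h g => \sum_(i <- s) f i h g).
Proof.
move=> pf; split; first by apply: emeasurable_sum => i; case: (pf i).
by move=> h g; apply: sume_ge0 => i _; apply: (pf i).2.
Qed.

Lemma ev_sum (I : Type) (s : seq I) (mu : 'I_K -> probability R R)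
    (f : I -> seq (R * R) -> R -> \bar R) k t (h : t.-tuple (R * R)) :
  (forall i, measurable_payoff (f i)) -> (t + k = n)%N ->
  ev mu PG pol (fun h g => \sum_(i <- s) f i h g) k h =
  \sum_(i <- s) ev mu PG pol (f i) k h.
Proof.
move=> pf tkn; elim: s => [|i s IH].
  rewrite big_nil -[RHS](ev_cst mu 0 k h).
  by congr (ev _ _ _ _ k h); apply/funext => h'; apply/funext => g; rewrite big_nil.
rewrite big_cons -IH -evD//; last exact: measurable_payoff_sum.
by congr (ev _ _ _ _ k h); apply/funext => h'; apply/funext => g; rewrite big_cons.
Qed.

End measurable_ev.

(** * Logarithm inequalities and the divergence of Bernoulli laws *)

Section log_inequalities.
Variable R : realType.
Implicit Types p q : R.

Lemma ler_mul_lnB p q : 0 < p -> 0 < q -> p * (ln q - ln p) <= q - p.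
Proof.
move=> p0 q0; have qp : -1 < q / p - 1 by rewrite ltrBrDr addNr divr_gt0.
have := le_ln1Dx qp; rewrite subrKC ln_div ?posrE// => lnqp.
rewrite (le_trans (ler_wpM2l (ltW p0) lnqp))//.
by rewrite mulrBr mulrCA divff ?gt_eqF// !mulr1.
Qed.

Lemma ln2_ge_half : 2^-1 <= ln (2 : R).
Proof.
have := @ler_mul_lnB 1 2^-1 ltr01; rewrite invr_gt0 ltr0n => /(_ isT).
by rewrite ln1 lnV ?posrE ?ltr0n//; lra.
Qed.

(* For two probability densities [p] and [q] the left-hand side integrates to one
   half minus their Kullback-Leibler divergence. *)
Lemma log_likelihood_le_min p q : 0 < p -> 0 < q ->
  p / 2 + p * (ln q - ln p) - (q - p) <= Num.min p q.
Proof.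
move=> p0 q0; rewrite le_min; apply/andP; split.
  by have := ler_mul_lnB p0 q0; lra.
(* Comparing [p] with [2 * q] instead of [q] produces the term [p * ln 2], which absorbs [p / 2]. *)
have := @ler_mul_lnB p (2 * q) p0; rewrite mulr_gt0 ?ltr0n// => /(_ isT).
rewrite lnM ?posrE ?ltr0n// -addrA mulrDr.
by have := ler_wpM2l (ltW p0) ln2_ge_half; lra.
Qed.

Definition bern_kl (t0 t1 : R) :=
  t0 * (ln t0 - ln t1) + (1 - t0) * (ln (1 - t0) - ln (1 - t1)).

(** By [ler_mul_lnB] the divergence is at most the chi-square divergence
    [(t0 - t1) ^+ 2 / (t1 * (1 - t1))], and [t1 * (1 - t1)] is at least 3/16, hence more than
    1/6. *)
Lemma bern_kl_le (t0 t1 : R) : 0 < t0 < 1 -> 4^-1 <= t1 <= 3 / 4 ->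
  bern_kl t0 t1 <= 6 * (t0 - t1) ^+ 2.
Proof.
move=> /andP[t00 t01] /andP[t1l t1u].
have t10 : 0 < t1 by lra.
have s10 : 0 < 1 - t1 by lra.
have s00 : 0 < 1 - t0 by lra.
have A : ln t0 - ln t1 <= (t0 - t1) / t1.
  by rewrite ler_pdivlMr// mulrC; exact: ler_mul_lnB.
have B : ln (1 - t0) - ln (1 - t1) <= (t1 - t0) / (1 - t1).
  rewrite ler_pdivlMr// mulrC; apply: le_trans (ler_mul_lnB s10 s00) _; lra.
rewrite /bern_kl; apply: (@le_trans _ _ (t0 * ((t0 - t1) / t1) +
    (1 - t0) * ((t1 - t0) / (1 - t1)))).
  by apply: lerD; rewrite ler_pM2l.
have -> : t0 * ((t0 - t1) / t1) + (1 - t0) * ((t1 - t0) / (1 - t1)) =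
    (t0 - t1) ^+ 2 / (t1 * (1 - t1)).
  by field; rewrite !gt_eqF.
rewrite ler_pdivrMr ?mulr_gt0// -mulrA [leRHS]mulrCA ler_peMr ?sqr_ge0//.
by nra.
Qed.

End log_inequalities.

(** * A two-point testing bound for adaptively sampled data *)

Section two_point.
Variables (R : realType) (K n : nat) (PG : probability R R).
Variable pol : nat -> seq (R * R) -> R -> 'I_K.
Hypothesis mpol : forall t, (t < n)%N -> forall i,
  measurable [set p : t.-tuple (R * R) * R | pol t p.1 p.2 = i].

(** Replays the policy: the tail [h'] is the history on which the arm behind the entry [z] was
    chosen. With [W] bounding the divergence of each arm, this is the divergence accumulated along
    [h]. *)
Fixpoint cost (W : 'I_K -> R) (h : seq (R * R)) : R :=
  if h is z :: h' then W (pol (size h') h' z.2) + cost W h' else 0.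

Lemma cost_ge0 W h : (forall i, 0 <= W i) -> 0 <= cost W h.
Proof. by move=> W0; elim: h => //= z h IH; rewrite addr_ge0. Qed.

Lemma cost_cst w h : cost (fun=> w) h = w * (size h)%:R.
Proof.
elim: h => [|z h IH] /=; first by rewrite mulr0.
by rewrite IH -natr1 mulrDr mulr1 addrC.
Qed.

Lemma cost_sum (I : Type) (s : seq I) (W : I -> 'I_K -> R) h :
  cost (fun i => \sum_(j <- s) W j i) h = \sum_(j <- s) cost (W j) h.
Proof.
by elim: h => [|z h IH] /=; [rewrite big1|rewrite IH big_split].
Qed.

Lemma measurable_cost W t : (t <= n)%N ->
  measurable_fun setT (fun h : t.-tuple (R * R) => (cost W h)%:E).
Proof.
elim: t => [_|t IH tn].
  by rewrite (_ : (fun _ => _) = cst 0%E)//; apply/funext => h; rewrite tuple0.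
have mt : measurable_fun setT (fun h : t.+1.-tuple (R * R) =>
    ([tuple of behead h], (tnth h ord0).2)).
  apply/measurable_fun_pair; first exact: measurable_behead.
  by apply: measurableT_comp => //; exact: measurable_tnth.
have mW : measurable_fun setT (fun p : t.-tuple (R * R) * R =>
    (W (pol t p.1 p.2))%:E).
  by apply: (measurable_fun_fin_cases (mpol tn)
    (G := fun i _ => (W i)%:E)) => i; exact: measurable_cst.
rewrite (_ : (fun _ => _) = (fun h : t.+1.-tuple (R * R) =>
   (((fun p : t.-tuple (R * R) * R => (W (pol t p.1 p.2))%:E) \o
     (fun h : t.+1.-tuple (R * R) =>
       ([tuple of behead h], (tnth h ord0).2))) h +
   ((fun h : t.-tuple (R * R) => (cost W h)%:E) \o
     (fun h : t.+1.-tuple (R * R) => [tuple of behead h])) h)%E)).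
  apply: emeasurable_funD; apply: measurableT_comp => //.
    exact: IH (ltnW tn).
  exact: measurable_behead.
apply/funext => h; case/tupleP: h => z h /=.
by rewrite tnth0 size_tuple EFinD.
Qed.

Lemma measurable_payoff_cost (a : R) W : 0 <= a -> (forall i, 0 <= W i) ->
  measurable_payoff n (fun h _ => (a * cost W h)%:E).
Proof.
move=> a0 W0; split; last by move=> h _; rewrite lee_fin mulr_ge0// cost_ge0.
under eq_fun do rewrite EFinM.
apply: emeasurable_funM; first exact: measurable_cst.
apply: (measurableT_comp (f := fun h : n.-tuple (R * R) => (cost W h)%:E)) => //.
exact: measurable_cost.
Qed.

(** Phrased through integrals so that one round of [ev] splits directly into the two latent
    draws. *)
Definition is_mixture (nu1 nu2 m : probability R R) (t : R) :=
  forall f : R -> \bar R, measurable_fun setT f -> (forall x, (0 <= f x)%E) ->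
  (\int[m]_x f x = t%:E * \int[nu1]_x f x + (1 - t)%:E * \int[nu2]_x f x)%E.

Variables (nu1 nu2 : probability R R) (mu0 mu1 : 'I_K -> probability R R).
Variables (tau0 tau1 : 'I_K -> R) (W : 'I_K -> R) (a : R).
Variables (f0 f1 : seq (R * R) -> R -> \bar R).
Hypothesis mix0 : forall i, is_mixture nu1 nu2 (mu0 i) (tau0 i).
Hypothesis mix1 : forall i, is_mixture nu1 nu2 (mu1 i) (tau1 i).
Hypothesis tau0P : forall i, 0 < tau0 i < 1.
Hypothesis tau1P : forall i, 0 < tau1 i < 1.
Hypothesis klW : forall i, bern_kl (tau0 i) (tau1 i) <= W i.
Hypothesis W0 : forall i, 0 <= W i.
Hypothesis a0 : 0 <= a.
Hypothesis pf0 : measurable_payoff n f0.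
Hypothesis pf1 : measurable_payoff n f1.
Hypothesis sep : forall h g, (a%:E <= f0 h g)%E \/ (a%:E <= f1 h g)%E.

(** [a] times the lower bound of [log_likelihood_le_min] for the smaller likelihood, with the
    divergence [C] already spent credited back at rate [p]. *)
Let Phi p q C := a * (p / 2 + p * (ln q - ln p) - (q - p) + p * C).

(** Revealing the coin splits [p] and [q] additively. The logarithmic terms drop by exactly
    [p * bern_kl (tau0 i) (tau1 i)], which the extra credit [p * W i] covers. *)
Let Phi_step (p q C : R) i : 0 < p -> 0 < q ->
  Phi p q C <= Phi (p * tau0 i) (q * tau1 i) (W i + C) +
    Phi (p * (1 - tau0 i)) (q * (1 - tau1 i)) (W i + C).
Proof.
move=> p0 q0; have /andP[? ?] := tau0P i; have /andP[? ?] := tau1P i.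
rewrite /Phi -[leRHS]mulrDr ler_wpM2l// !lnM ?posrE ?subr_gt0//.
have := ler_wpM2l (ltW p0) (klW i); rewrite /bern_kl.
set A := ln p; set B := ln q; set u0 := ln _; set u1 := ln _; set v0 := ln _.
set v1 := ln _; set t := tau0 i; set s := tau1 i; set w := W i.
by nra.
Qed.

(* The induction is on the number of remaining rounds; [p] and [q] are the
   likelihoods of the history under the two environments, where each outcome is
   thought of as revealing which of [nu1], [nu2] it was drawn from. *)
Lemma two_point_likelihood k t (h : t.-tuple (R * R)) (p q : R) :
  (t + k = n)%N -> 0 < p -> 0 < q ->
  ((Phi p q (cost W h))%:E <=
   p%:E * ev mu0 PG pol (fun h g => f0 h g + (a * cost W h)%:E) k h +
   q%:E * ev mu1 PG pol f1 k h)%E.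
Proof.
have pf0' : measurable_payoff n (fun h g => f0 h g + (a * cost W h)%:E)%E.
  exact/measurable_payoffD/measurable_payoff_cost.
elim: k t h p q => [|k IH] t h p q tkn p0 q0.
  have tn : t = n by rewrite -tkn addn0.
  subst t; rewrite /=; apply: le_lincomb_integral.
  - exact: ltW.
  - exact: ltW.
  - exact: (measurable_payoff_section h pf0').
  - exact: measurable_payoff_section.
  - by move=> g; apply: pf0'.2.
  - by move=> g; apply: pf1.2.
  move=> g; have := log_likelihood_le_min p0 q0.
  rewrite le_min => /andP[/(ler_wpM2l a0) Hp /(ler_wpM2l a0) Hq].
  have c0 : 0 <= a * cost W h by rewrite mulr_ge0// cost_ge0.
  (* Whichever payoff is at least [a], the right side is at least [a] times [p] or [q] plus the cost
     term, and the smaller of [p] and [q] dominates the logarithmic expression. *)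
  have [af|af] := sep h g.
    apply: (@le_trans _ _ (p * (a + a * cost W h))%:E).
      by rewrite lee_fin /Phi; lra.
    rewrite EFinM -[leLHS]adde0; apply: leeD.
      by rewrite lee_pmul2l ?lte_fin// EFinD leeD2r.
    by rewrite mule_ge0 ?lee_fin ?(ltW q0)//; apply: pf1.2.
  apply: (@le_trans _ _ (p * (a * cost W h) + q * a)%:E).
    by rewrite lee_fin /Phi; lra.
  rewrite EFinD !EFinM; apply: leeD.
    by rewrite lee_pmul2l ?lte_fin// leeDr//; apply: pf0.2.
  by rewrite lee_pmul2l ?lte_fin.
rewrite /=; apply: le_lincomb_integral.
- exact: ltW.
- exact: ltW.
- exact: (measurable_ev_inner PG mpol mu0 h pf0' tkn).
- exact: (measurable_ev_inner PG mpol mu1 h pf1 tkn).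
- by move=> g; apply: integral_ge0 => y _; apply/ev_ge0/pf0'.2.
- by move=> g; apply: integral_ge0 => y _; apply/ev_ge0/pf1.2.
move=> g; set i := pol _ _ _.
have m0 := measurable_ev_cons PG mpol mu0 h g pf0' tkn.
have m1 := measurable_ev_cons PG mpol mu1 h g pf1 tkn.
have e0 y := @ev_ge0 R K PG pol mu0 _ k ((y, g) :: h) pf0'.2.
have e1 y := @ev_ge0 R K PG pol mu1 _ k ((y, g) :: h) pf1.2.
have /andP[? ?] := tau0P i; have /andP[? ?] := tau1P i.
have IHy p' q' y : 0 < p' -> 0 < q' -> _ :=
  IH t.+1 [the t.+1.-tuple (R * R) of (y, g) :: h] p' q'
    (etrans (addSnnS t k) tkn).
have I0 (f : R -> \bar R) (m : probability R R) :
  (forall x, (0 <= f x)%E) -> (0 <= \int[m]_x f x)%E by move=> f0'; exact: integral_ge0.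
(* Once the latent component [nu] is fixed, both environments draw the outcome from the same law, so
   the induction hypothesis can be integrated. *)
have bound (nu : probability R R) p' q' : 0 < p' -> 0 < q' ->
    ((Phi p' q' (W i + cost W h))%:E <=
     p'%:E * \int[nu]_y ev mu0 PG pol
       (fun h g => f0 h g + (a * cost W h)%:E) k ((y, g) :: h) +
     q'%:E * \int[nu]_y ev mu1 PG pol f1 k ((y, g) :: h))%E.
  move=> p'0 q'0; apply: le_lincomb_integral => //; rewrite ?ltW// => y.
  exact: IHy.
have b1 := bound nu1 (p * tau0 i) (q * tau1 i).
have b2 := bound nu2 (p * (1 - tau0 i)) (q * (1 - tau1 i)).
rewrite (mix0 i)// (mix1 i)//.
move: b1 b2 (I0 _ nu1 e0) (I0 _ nu2 e0) (I0 _ nu1 e1) (I0 _ nu2 e1).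
set A1 := integral _ _ _; set B1 := integral _ _ _.
set A2 := integral _ _ _; set B2 := integral _ _ _ => b1 b2 A10 A20 B10 B20.
have t00 : (0 <= (tau0 i)%:E :> \bar R)%E by rewrite lee_fin ltW.
have t10 : (0 <= (tau1 i)%:E :> \bar R)%E by rewrite lee_fin ltW.
have s00 : (0 <= (1 - tau0 i)%:E :> \bar R)%E by rewrite lee_fin subr_ge0 ltW.
have s10 : (0 <= (1 - tau1 i)%:E :> \bar R)%E by rewrite lee_fin subr_ge0 ltW.
rewrite (ge0_muleDr p%:E (mule_ge0 t00 A10) (mule_ge0 s00 A20)).
rewrite (ge0_muleDr q%:E (mule_ge0 t10 B10) (mule_ge0 s10 B20)).
rewrite !muleA -!EFinM addeACA.
apply: (@le_trans _ _ ((Phi (p * tau0 i) (q * tau1 i) (W i + cost W h))%:E +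
   (Phi (p * (1 - tau0 i)) (q * (1 - tau1 i)) (W i + cost W h))%:E)%E).
  by rewrite -EFinD lee_fin; exact: Phi_step.
by apply: leeD; [apply: b1|apply: b2]; rewrite mulr_gt0// subr_gt0.
Qed.

(** The empty history has likelihood 1 in both environments and no cost, and [Phi 1 1 0] is
    [a / 2]. *)
Lemma two_point_bound :
  ((a / 2)%:E <= ev mu0 PG pol f0 n [::] + ev mu1 PG pol f1 n [::] +
    ev mu0 PG pol (fun h _ => (a * cost W h)%:E) n [::])%E.
Proof.
have := @two_point_likelihood n 0 [tuple] 1 1 erefl ltr01 ltr01.
rewrite !mul1e /Phi !subrr mulr0 !addr0 subr0 mul1r => /le_trans; apply.
have := @evD R K n PG pol mpol mu0 f0 _ n 0 [tuple] pf0
  (measurable_payoff_cost a0 W0) erefl.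
by move=> /= ->; rewrite addeAC.
Qed.

End two_point.

(** * Mixtures of two probability measures *)

Section mixture_probability.
Variables (R : realType) (nu1 nu2 : probability R R) (t : R).
Hypothesis t01 : 0 <= t <= 1.

Let t0 : 0 <= t. Proof. by case/andP: t01. Qed.
Let s0 : 0 <= 1 - t. Proof. by rewrite subr_ge0; case/andP: t01. Qed.

Definition mixture : set R -> \bar R :=
  measure_add (mscale (NngNum t0) nu1) (mscale (NngNum s0) nu2).

HB.instance Definition _ := Measure.on mixture.

Lemma mixtureE A : mixture A = (t%:E * nu1 A + (1 - t)%:E * nu2 A)%E.
Proof. exact: measure_addE. Qed.

Let mixture_setT : mixture setT = 1%E.
Proof. by rewrite mixtureE !probability_setT !mule1 -EFinD subrKC. Qed.

HB.instance Definition _ :=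
  Measure_isProbability.Build _ _ _ mixture mixture_setT.

Lemma mixtureP : is_mixture nu1 nu2 mixture t.
Proof.
move=> f mf f0.
by rewrite ge0_integral_measure_add// !ge0_integral_mscale.
Qed.

End mixture_probability.

(** * The Lebesgue-Stieltjes law of a cdf *)

Section probability_of_cdf.
Variables (R : realType) (a b : R) (F : R -> R).
Hypothesis cdfF : is_cdf_ab a b F.

Definition cdf_cumulative : R -> R := F.

Let Fnd : nondecreasing cdf_cumulative.
Proof. by case: cdfF => -[]. Qed.
Let Frc : right_continuous cdf_cumulative.
Proof. by case: cdfF => -[]. Qed.
HB.instance Definition _ := isCumulative.Build R _ R cdf_cumulative Fnd Frc.

Let FNy : cdf_cumulative @ -oo --> (0 : R).
Proof. by case: cdfF => -[]. Qed.
Let Fy : cdf_cumulative @ +oo --> (1 : R).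
Proof. by case: cdfF => -[]. Qed.
HB.instance Definition _ :=
  isCumulativeBounded.Build R 0 1 cdf_cumulative FNy Fy.

Let idTR : measurableTypeR R -> R := idfun.

#[local] HB.instance Definition _ :=
  @isMeasurableFun.Build _ _ _ _ idTR (@measurable_id _ _ setT).

Lemma probability_of_cdf : exists m : probability R R,
  forall x, m [set y : R | y <= x] = (F x)%:E.
Proof.
pose lsf := lebesgue_stieltjes_measure cdf_cumulative.
exists (distribution lsf (idTR : {RV lsf >-> R})) => x.
rewrite -(cdf_lebesgue_stieltjes_id cdf_cumulative x) /cdf.
by congr (distribution _ _ _).
Qed.

End probability_of_cdf.

(** * Laws with cdf in the class are concentrated on [a,b] *)

Section cdf_support.
Variables (R : realType) (a b : R) (F : R -> R) (m : probability R R).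
Hypothesis cdfF : is_cdf_ab a b F.
Hypothesis mF : forall x, m [set y : R | y <= x] = (F x)%:E.

Let measurable_le (x : R) : measurable [set y : R | y <= x].
Proof. by rewrite (_ : [set y | _] = `]-oo, x]%classic). Qed.

Lemma cdf_measure_lt0 x : x < a -> m [set y : R | y <= x] = 0%E.
Proof.
move=> xa; apply/eqP; rewrite eq_le measure_ge0 andbT mF lee_fin.
case: cdfF => -[nd _ _ _] [Fa _].
apply: (cvgr_to_ge Fa); near=> y; apply: nd; near: y.
exact: nbhs_left_ge.
Unshelve. all: by end_near. Qed.

Lemma measurable_support : measurable [set y : R | a <= y <= b].
Proof. by rewrite (_ : [set y | _] = `[a, b]%classic). Qed.

Lemma cdf_support : m (~` [set y : R | a <= y <= b]) = 0%E.
Proof.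
have mb : m (~` [set y : R | y <= b]) = 0%E.
  by rewrite probability_setC// mF (proj2 (proj2 cdfF)) subee.
(* The open half-line below [a] is exhausted by the closed ones ending at [a - 1/(k+1)], each null
   by [cdf_measure_lt0]. *)
have ma : m.-negligible [set y : R | y < a].
  apply: negligibleS (negligible_bigcup
    (F := fun k : nat => [set y : R | y <= a - k.+1%:R^-1]) _) => [y /= ya|k].
    have /ltr_add_invr[k /ltW ka] : y < a by [].
    by exists k => //=; rewrite lerBrDr.
  apply/negligibleP => //; apply: cdf_measure_lt0.
  by rewrite ltrBlDr ltrDl invr_gt0 ltr0n.
apply/negligibleP; first by apply: measurableC; exact: measurable_support.
apply: negligibleS (negligibleU ma (_ : m.-negligible (~` [set y | y <= b]))).
  by move=> y /=; case: (ltP y a) => [ya _|ay yb]; [left|right].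
by apply/negligibleP => //; exact: measurableC.
Qed.

End cdf_support.

(** * Replacing a policy by one defined through clipped outcomes *)

Section clipping.
Variables (R : realType) (a b : R).
Hypothesis ab : a <= b.

(** A policy is controlled only on histories with outcomes in [a,b]. Precomposing it with [clip]
    makes it measurable on all histories. *)
Definition clip (y : R) := Num.max a (Num.min b y).

Definition clip_history (h : seq (R * R)) := [seq (clip z.1, z.2) | z <- h].

Lemma clip_itv y : a <= clip y <= b.
Proof. by rewrite /clip le_max lexx ge_max ab ge_min lexx. Qed.

Lemma clip_id y : a <= y <= b -> clip y = y.
Proof. by case/andP=> ay yb; rewrite /clip (min_idPr yb) (max_idPr ay). Qed.

Lemma clip_nondecreasing : nondecreasing_fun clip.
Proof.
move=> x y xy; rewrite /clip ge_max le_max lexx /= le_max; apply/orP; right.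
by rewrite le_min !ge_min lexx xy orbT.
Qed.

Lemma hdom_clip t (h : t.-tuple (R * R)) :
  hdom a b (map_tuple (fun z => (clip z.1, z.2)) h).
Proof. by move=> j; rewrite tnth_map; exact: clip_itv. Qed.

Lemma measurable_clip_history t : measurable_fun setT
  (fun p : t.-tuple (R * R) * R =>
     (map_tuple (fun z => (clip z.1, z.2)) p.1, p.2)).
Proof.
apply/measurable_fun_pair => //.
apply/measurable_fun_tnthP => i.
rewrite (_ : _ \o _ = (fun z : R * R => (clip z.1, z.2)) \o
   ((fun h : t.-tuple (R * R) => tnth h i) \o fst)); last first.
  by apply/funext => p /=; rewrite tnth_map.
apply: measurableT_comp.
  apply/measurable_fun_pair => //; apply: measurableT_comp => //.
  exact: nondecreasing_measurable clip_nondecreasing.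
by apply: measurableT_comp => //; exact: measurable_tnth.
Qed.

Lemma measurable_clip_preimage t (Q : set (seq (R * R) * R)) :
  measurable ((@hdom R a b t `*` [set: R]) `&`
    [set p : t.-tuple (R * R) * R | Q (tval p.1, p.2)]) ->
  measurable [set p : t.-tuple (R * R) * R | Q (clip_history p.1, p.2)].
Proof.
move=> mQ; have := measurable_clip_history measurableT mQ.
rewrite setTI; congr measurable; apply/seteqP; split => p /=.
  by case.
by move=> Qp; split => //; split => //; exact: hdom_clip.
Qed.

(** Almost every outcome lies in [a,b], where clipping is the identity. The original policy may
    yield non-measurable integrands, hence the appeal to [integral_conull]. *)
Lemma ev_clip K (mu : 'I_K -> probability R R) PG pol f k h :
  (forall i, mu i (~` [set y : R | a <= y <= b]) = 0%E) ->
  clip_history h = h ->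
  ev mu PG pol f k h =
  ev mu PG (fun t h g => pol t (clip_history h) g)
    (fun h g => f (clip_history h) g) k h.
Proof.
move=> mu0; elim: k h => [|k IH] h hh /=; first by rewrite hh.
apply: eq_integral => g _; rewrite hh.
have mab := @measurable_support R a b.
rewrite (integral_conull _ mab (mu0 _)) [RHS](integral_conull _ mab (mu0 _)).
apply: eq_integral => y /[1!inE] /= aby; apply: IH.
by rewrite /= hh clip_id.
Qed.

End clipping.

(** * Regret along the segment between [H1] and [H2] *)

Section linear_regret.
Variables (R : realType) (T : (R -> R) -> R) (H1 H2 : R -> R) (cminus : R).
Hypothesis cminus0 : 0 < cminus.
Hypothesis T_growth : forall t1 t2 : R, 0 <= t1 -> t1 <= t2 -> t2 <= 1 ->
  cminus * (t2 - t1) <= T (Jmix H1 H2 t2) - T (Jmix H1 H2 t1).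
Variables (K : nat) (M : set 'rV[R]_K).
Hypothesis M_simplex : M `<=` @simplex R K.
Implicit Types (tau : 'I_K -> R) (d : 'rV[R]_K).

Let J (tau : 'I_K -> R) := fun i => Jmix H1 H2 (tau i).

(** Weights summing to one keep the mixture on the segment, so a recommendation matters only through
    the scalar [dotv tau d]. *)
Lemma mixcdf_Jmix tau d : simplex d -> mixcdf d (J tau) = Jmix H1 H2 (dotv tau d).
Proof.
move=> [_ d1]; apply/funext => x.
rewrite /mixcdf /J /Jmix -[in RHS]d1 /dotv -sumrB !mulr_suml -big_split.
by apply: eq_bigr => i _ /=; ring.
Qed.

Lemma dotv_itv tau d : (forall i, 0 <= tau i <= 1) -> simplex d ->
  0 <= dotv tau d <= 1.
Proof.
move=> tau01 [d0 d1]; apply/andP; split.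
  by apply: sumr_ge0 => i _; rewrite mulr_ge0//; case/andP: (tau01 i).
rewrite -d1; apply: ler_sum => i _; rewrite ler_piMl//.
by case/andP: (tau01 i).
Qed.

Lemma dotv_affine x s (u : 'I_K -> R) d : simplex d ->
  dotv (fun i => x + s * u i) d = x + s * dotv u d.
Proof.
move=> [_ d1]; rewrite /dotv mulr_sumr -[in RHS](mulr1 x) -d1 mulr_sumr.
by rewrite -big_split; apply: eq_bigr => i _ /=; ring.
Qed.

Lemma regret_ge0 F d : M d -> (0 <= regret T M F d)%E.
Proof. by move=> Md; rewrite sube_ge0//; apply: ereal_sup_ubound; exists d. Qed.

Lemma regret_ge_dotv tau d d' : (forall i, 0 <= tau i <= 1) -> M d -> M d' ->
  ((cminus * (dotv tau d' - dotv tau d))%:E <= regret T M (J tau) d)%E.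
Proof.
move=> tau01 Md Md'; have [le|/ltW le] := leP (dotv tau d') (dotv tau d).
  apply: le_trans (regret_ge0 _ Md).
  by rewrite lee_fin mulr_ge0_le0 ?(ltW cminus0)// subr_le0.
apply: (@le_trans _ _ ((T (mixcdf d' (J tau)))%:E - (T (mixcdf d (J tau)))%:E)%E).
  rewrite -EFinB lee_fin !mixcdf_Jmix; try exact: M_simplex.
  have /andP[? _] := dotv_itv tau01 (M_simplex Md).
  have /andP[_ ?] := dotv_itv tau01 (M_simplex Md').
  exact: T_growth.
by rewrite leeB//; apply: ereal_sup_ubound; exists d'.
Qed.

(** As [d] lies in [A], [dotv u d] is at most [supdot A u]. Competitors [d'] are bounded one by one
    before taking the supremum, so no maximiser is chosen. *)
Lemma regret_ge_gap x s (u : 'I_K -> R) r (A : set 'rV[R]_K) d :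
  (forall i, 0 <= x + s * u i <= 1) -> 0 < s ->
  (r%:E <= supdot M u - supdot A u)%E -> A d -> M d ->
  ((cminus * s * r)%:E <= regret T M (J (fun i => (x + s * u i)%R)) d)%E.
Proof.
move=> u01 s0 gap Ad Md; have cs0 : 0 < cminus * s by rewrite mulr_gt0.
have ub : (supdot M u <= (cminus * s)^-1%:E *
    regret T M (J (fun i => (x + s * u i)%R)) d + (dotv u d)%:E)%E.
  apply: ge_ereal_sup => _ [d' Md' <-].
  rewrite -leeBlDr// -EFinB lee_pdivlMl// -EFinM.
  have := regret_ge_dotv u01 Md Md'.
  rewrite !dotv_affine; try exact: M_simplex.
  by congr (_%:E <= _)%E; ring.
rewrite EFinM -lee_pdivlMl//; apply: le_trans gap _.
apply: (@le_trans _ _ (supdot M u - (dotv u d)%:E)%E).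
  by rewrite leeB//; apply: ereal_sup_ubound; exists d.
by rewrite leeBlDr.
Qed.

Lemma measurable_regret disp (X : measurableType disp) (rec : X -> 'rV[R]_K) tau :
  (forall i, 0 <= tau i <= 1) -> (forall x, M (rec x)) ->
  (forall B : set 'rV[R]_K, (<<s [set A : set 'rV[R]_K | open A] >>) B ->
     measurable [set x | B (rec x)]) ->
  measurable_fun setT (fun x => regret T M (J tau) (rec x)).
Proof.
move=> tau01 Mrec mrec; rewrite /regret; apply: emeasurable_funB => //.
(* [T] is increasing along the segment; clipping the parameter to [0,1] extends this to a monotone,
   hence Borel, function on the line. *)
pose G y := T (Jmix H1 H2 (clip 0 1 y)).
rewrite (_ : (fun x => _) = EFin \o (G \o (fun x => dotv tau (rec x)))); last first.
  apply/funext => x /=; rewrite mixcdf_Jmix; last exact: M_simplex.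
  by rewrite /G clip_id//; apply: dotv_itv => //; exact: M_simplex.
apply/measurable_EFinP; apply: measurableT_comp.
  apply: nondecreasing_measurable => // y z yz; rewrite /G -subr_ge0.
  have c01 y' := clip_itv (@ler01 R) y'.
  have cyz := @clip_nondecreasing R 0 1 _ _ yz.
  apply: le_trans (T_growth _ cyz _); last 2 first.
  - by case/andP: (c01 y).
  - by case/andP: (c01 z).
  by rewrite mulr_ge0 ?(ltW cminus0)// subr_ge0.
apply: (measurability (@RGenOInfty.G R)).
  exact: RGenOInfty.measurableE.
move=> _ [_ [x ->] <-]; rewrite setTI.
(* The preimage of a ray under the continuous [dotv tau] is open, and so among the sets covered by
   the hypothesis on [rec]. *)
apply: (mrec [set d | dotv tau d \in `]x, +oo[]).
apply: sub_sigma_algebra => /=.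
have ctau : continuous (@dotv R K tau).
  apply: continuous_big => [|i _ d]; first exact: add_continuous.
  apply: (@continuousM R 'rV[R]_K (fun=> tau i) (fun e : 'rV[R]_K => e 0 i) d).
    exact: cst_continuous.
  exact: coord_continuous.
by apply: (@open_comp _ _ (@dotv R K tau) `]x, +oo[%classic) => // d _; exact: ctau.
Qed.

End linear_regret.

(** * Counting over the blocks of a partition *)

Section partition_facts.
Variables (K : nat) (P : {set {set 'I_K}}).
Hypothesis partP : finset.partition P [set: 'I_K]%SET.

Lemma card_partition_le : (#|P| <= K)%N.
Proof.
have := card_partition partP; rewrite cardsT card_ord => KE.
apply: leq_trans (_ : _ <= \sum_(B in P) #|B|)%N _; last by rewrite -KE.
rewrite -sum1_card; apply: leq_sum => B PB; rewrite card_gt0.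
by apply: contraTneq PB => ->; case/and3P: partP.
Qed.

Lemma card_partition_gt0 : (0 < K)%N -> (0 < #|P|)%N.
Proof.
move=> K0; rewrite card_gt0; apply/set0Pn.
by exists (finset.pblock P (Ordinal K0)); rewrite pblock_mem// (cover_partition partP).
Qed.

(** Only the block of [i] contributes; consequently the pull counts of the blocks add up to the
    number of rounds. *)
Lemma sum_partition_mem (R : pzSemiRingType) (i : 'I_K) :
  \sum_(B in P) (i \in B)%:R = 1 :> R.
Proof.
have icov : i \in finset.cover P.
  by rewrite (cover_partition partP) finset.in_setT.
rewrite (bigD1 (finset.pblock P i)) ?pblock_mem//= mem_pblock icov big1 ?addr0//.
move=> B /andP[PB Bi]; case: (boolP (i \in B)) => // iB.
by rewrite (def_pblock (partition_trivIset partP) PB iB) eqxx in Bi.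
Qed.

End partition_facts.

(** * The regret bound for one partition and one choice of separating data *)

Section lower_bound.
Variables (R : realType) (a b : R) (D : set (R -> R)) (T : (R -> R) -> R).
Variables (H1 H2 : R -> R) (cminus : R).
Hypothesis ab : a < b.
Hypothesis D_cdf : D `<=` is_cdf_ab a b.
Hypothesis DJ : forall tau : R, 0 <= tau <= 1 -> D (Jmix H1 H2 tau).
Hypothesis cminus0 : 0 < cminus.
Hypothesis T_growth : forall t1 t2 : R, 0 <= t1 -> t1 <= t2 -> t2 <= 1 ->
  cminus * (t2 - t1) <= T (Jmix H1 H2 t2) - T (Jmix H1 H2 t1).
Variables (nu1 nu2 : probability R R).
Hypothesis nu1P : forall x, nu1 [set y : R | y <= x] = (H1 x)%:E.
Hypothesis nu2P : forall x, nu2 [set y : R | y <= x] = (H2 x)%:E.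
Variables (K : nat) (M : set 'rV[R]_K).
Hypothesis M_simplex : M `<=` @simplex R K.
Variables (pol : nat -> nat -> seq (R * R) -> R -> 'I_K)
          (rec : nat -> seq (R * R) -> R -> 'rV[R]_K).
Hypothesis policy : is_policy a b M pol rec.
Variables (PG : probability R R) (n : nat).
Hypothesis K0 : (0 < K)%N.
Hypothesis Kn : (K <= n)%N.
Variable d0 : 'rV[R]_K.
Hypothesis Md0 : M d0.

Let pol' t h g := pol n t (clip_history a b h) g.
(* Only histories of length [n] are known to give a recommendation in [M]. *)
Let rec' h g := if size h == n then rec n (clip_history a b h) g else d0.
Let J (tau : 'I_K -> R) := fun i => Jmix H1 H2 (tau i).
Let payoff tau h g := regret T M (J tau) (rec' h g).
Let S := ereal_sup [set e | exists (tau : 'I_K -> R) (mu : 'I_K -> probability R R),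
  [/\ (forall i, (0 <= tau i <= 1)%R),
      (forall i (x : R), mu i [set y : R | (y <= x)%R] = (Jmix H1 H2 (tau i) x)%:E) &
      e = exp_regret T M pol rec PG n (fun i => Jmix H1 H2 (tau i)) mu]].

Let mpol' t : (t < n)%N -> forall i,
  measurable [set p : t.-tuple (R * R) * R | pol' t p.1 p.2 = i].
Proof.
move=> tn i; have [+ _ _] := policy Kn => /(_ _ tn i) mp.
exact: (measurable_clip_preimage (ltW ab)
  (Q := fun z : seq (R * R) * R => pol n t z.1 z.2 = i) mp).
Qed.

Let Mrec' h g : M (rec' h g).
Proof.
rewrite /rec'; case: eqP => // hn; have [_ _ Mrec] := policy Kn.
have hn' : size h == n by apply/eqP.
exact: (Mrec _ g (@hdom_clip R a b (ltW ab) n (Tuple hn'))).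
Qed.

Let measurable_payoff' tau : (forall i, 0 <= tau i <= 1) ->
  measurable_payoff n (payoff tau).
Proof.
move=> tau01; split; last by move=> h g; exact: regret_ge0.
have [_ mrec Mrec] := policy Kn.
apply: (measurable_regret cminus0 T_growth M_simplex
  (rec := fun p : n.-tuple (R * R) * R => rec' p.1 p.2)) => //.
move=> B /mrec mB.
rewrite (_ : [set _ | _] = [set p : n.-tuple (R * R) * R |
    B (rec n (clip_history a b p.1) p.2)]).
  exact: (measurable_clip_preimage (ltW ab)
    (Q := fun z : seq (R * R) * R => B (rec n z.1 z.2)) mB).
by apply/seteqP; split => p /=; rewrite /rec' size_tuple eqxx.
Qed.

(** Mixing [nu1] and [nu2] arm by arm realises the cdfs [Jmix H1 H2 (tau i)], so the clipped
    policy's expected regret is one of the values under the supremum [S]. *)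
Let environment tau : (forall i, 0 <= tau i <= 1) ->
  exists2 mu : 'I_K -> probability R R,
    forall i, is_mixture nu1 nu2 (mu i) (tau i) &
    (ev mu PG pol' (payoff tau) n [::] <= S)%E.
Proof.
move=> tau01; exists (fun i => mixture nu1 nu2 (tau01 i)) => [i|].
  exact: mixtureP.
set mu := fun i => _.
have muP i x : mu i [set y : R | y <= x] = (Jmix H1 H2 (tau i) x)%:E.
  by rewrite /mu/= mixtureE nu1P nu2P -!EFinM -EFinD.
apply: ereal_sup_ubound; exists tau, mu; split => //.
rewrite [RHS](@ev_clip R a b) => [||//]; last first.
  by move=> i; apply: cdf_support (muP i); exact/D_cdf/DJ.
apply: (@eq_ev R K n PG pol' mu _ _ n 0 [tuple]) => // h g.
by rewrite /payoff /rec' size_tuple eqxx.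
Qed.

Lemma sup_regret_ge0 : (0 <= S)%E.
Proof.
have half01 (i : 'I_K) : 0 <= (2^-1 : R) <= 1 by lra.
have [mu _] := environment half01; apply: le_trans.
by apply: ev_ge0 => h g; exact: regret_ge0.
Qed.

Lemma gap_lower_bound (P : {set {set 'I_K}}) (A : set 'rV[R]_K)
    (v : 'I_K -> R) (w : {set 'I_K} -> 'I_K -> R) (r : R) :
  finset.partition P [set: 'I_K]%SET ->
  (forall j, -1 <= v j <= 1) ->
  (forall B, B \in P -> forall j, j \in B -> -1 <= w B j <= 1) ->
  (r%:E <= supdot M v - supdot A v)%E ->
  (forall B, B \in P ->
    r%:E <= supdot M (addB v B (w B)) - supdot (M `\` A) (addB v B (w B)))%E ->
  0 < r ->
  ((cminus / 64 * Num.sqrt (#|P|%:R / n%:R) * r)%:E <= S)%E.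
Proof.
move=> partP v1 w1 gapA gapB r0.
have n0 : 0 < n%:R :> R by rewrite ltr0n (leq_trans K0).
have l0 : 0 < #|P|%:R :> R by rewrite ltr0n (card_partition_gt0 partP).
have ln1 : #|P|%:R / n%:R <= 1 :> R.
  by rewrite ler_pdivrMr// mul1r ler_nat (leq_trans (card_partition_le partP)).
have ln0 : 0 < #|P|%:R / n%:R :> R by rewrite divr_gt0.
(* Since the blocks number at most [n], [s] is at most 1/8. The parameters below move by at most
   [2 * s] from 1/2 and stay in [1/4, 3/4]. *)
pose s := Num.sqrt (#|P|%:R / n%:R) / 8 : R.
have s0 : 0 < s by rewrite divr_gt0 ?sqrtr_gt0.
have s8 : s <= 8^-1.
  by rewrite /s ler_piMl ?invr_ge0// -[leRHS]sqrtr1 ler_sqrt.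
have s2 : s ^+ 2 = #|P|%:R / n%:R / 64.
  by rewrite /s expr_div_n sqr_sqrtr ?(ltW ln0)// -natrX.
pose al := cminus * s * r.
have al0 : 0 < al := mulr_gt0 (mulr_gt0 cminus0 s0) r0.
(* The factor 1/64 is 1/8 from the definition of [s] times 1/8 left after averaging over blocks. *)
have -> : cminus / 64 * Num.sqrt (#|P|%:R / n%:R) * r = al / 8.
  by rewrite /al /s; field.
pose tau0 i := 2^-1 + s * v i.
have tau0P i : 4^-1 <= tau0 i <= 3 / 4.
  by have /andP[] := v1 i; rewrite /tau0; nra.
pose tauB B i := 2^-1 + s * addB v B (w B) i.
have tauBP B i : B \in P -> 4^-1 <= tauB B i <= 3 / 4.
  move=> PB; have /andP[] := v1 i; rewrite /tauB /addB; case: ifP => iB.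
    by have /andP[] := w1 B PB i iB; nra.
  by nra.
have w01 (x : R) : 4^-1 <= x <= 3 / 4 -> 0 <= x <= 1 by lra.
have w01s (x : R) : 4^-1 <= x <= 3 / 4 -> 0 < x < 1 by lra.
have [mu0 mix0 mu0S] := environment (fun i => w01 _ (tau0P i)).
(* [tau0] and [tauB B] agree off [B] and differ by at most [s] on it, so [bern_kl_le] gives this
   bound for each arm. *)
pose W (B : {set 'I_K}) (i : 'I_K) : R := 6 * s ^+ 2 * (i \in B)%:R.
have W0 B i : 0 <= W B i by rewrite !mulr_ge0 ?sqr_ge0.
pose x B := ev mu0 PG pol' (fun h _ => (al * cost pol' (W B) h)%:E) n [::].
have key B : B \in P -> ((al / 2)%:E <= S + S + x B)%E.
  move=> PB; have tBP i := tauBP B i PB.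
  have [muB mixB muBS] := environment (fun i => w01 _ (tBP i)).
  apply: (@le_trans _ _ (ev mu0 PG pol' (payoff tau0) n [::] +
    ev muB PG pol' (payoff (tauB B)) n [::] + x B)%E); last first.
    by rewrite leeD2r// leeD.
  apply: (two_point_bound PG mpol' mix0 mixB (fun i => w01s _ (tau0P i))
    (fun i => w01s _ (tBP i))) => //.
  - move=> i; apply: le_trans (bern_kl_le (w01s _ (tau0P i)) (tBP i)) _.
    rewrite /W /tau0 /tauB /addB -mulrA ler_pM2l//.
    case: ifP => iB; last by rewrite addr0 subrr expr0n mulr0.
    have /andP[? ?] := w1 B PB i iB.
    rewrite mulr1 mulrDr opprD addrACA subrr add0r opprD addrA subrr add0r.
    rewrite sqrrN exprMn ler_piMr ?sqr_ge0//; nra.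
  - exact: ltW.
  - by apply: measurable_payoff' => i; exact: w01.
  - by apply: measurable_payoff' => i; exact: w01.
  move=> h g; have [Ad|NAd] := pselect (A (rec' h g)); [left|right].
    apply: (regret_ge_gap cminus0 T_growth M_simplex _ s0 gapA) => //.
    by move=> i; exact: w01 (tau0P i).
  apply: (regret_ge_gap cminus0 T_growth M_simplex _ s0 (gapB B PB)) => //.
  by move=> i; exact: w01 (tBP i).
have sumx : (\sum_(B in P) x B = (al * (6 * s ^+ 2 * n%:R))%:E)%E.
  rewrite -big_enum /= /x.
  rewrite -(@ev_sum R K n PG pol' mpol' _ (enum P) mu0
    (fun B h _ => (al * cost pol' (W B) h)%:E) n 0 [tuple]) //; last first.
    by move=> B; apply: measurable_payoff_cost => //; exact: ltW.
  rewrite -[RHS](ev_cst PG pol' mu0 _ n [::]).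
  apply: (@eq_ev R K n PG pol' mu0 _ _ n 0 [tuple]) => // h g.
  rewrite sumEFin -mulr_sumr -cost_sum; congr (_ * _)%:E.
  rewrite -[in RHS](size_tuple h) -(cost_cst pol'); congr (cost _ _ _).
  apply/funext => i; rewrite big_enum /= -mulr_sumr.
  by rewrite (sum_partition_mem partP) mulr1.
have := sup_regret_ge0; case: S key => [y||] key // _; last by rewrite leey.
have {}key B : B \in P -> ((al / 2 - (y + y))%:E <= x B)%E.
  by move=> /key; rewrite -EFinD -leeBlDl// -EFinB.
(* With l blocks the sum reads l (al/2 - 2y) <= al l 6/64. Hence y >= 13 al/64, which exceeds
   al/8. *)
have : (\sum_(B in P) (al / 2 - (y + y))%:E <= \sum_(B in P) x B)%E.
  exact: lee_sum.
rewrite sumx sumEFin !lee_fin sumr_const s2.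
have -> : 6 * (#|P|%:R / n%:R / 64) * n%:R = #|P|%:R * (6 / 64) :> R.
  by field; rewrite gt_eqF.
rewrite -[leLHS]mulr_natl [leRHS]mulrCA ler_pM2l//; lra.
Qed.

End lower_bound.

(** * From individual separating data to the supremum [kappa] and the maximum over partitions *)

Theorem theoremB2 (R : realType) (a b : R) (D : set (R -> R))
  (T : (R -> R) -> R) (C : R) (H1 H2 : R -> R) (cminus : R) :
  a < b ->
  D !=set0 ->
  D `<=` is_cdf_ab a b ->
  (forall F G (lam : R), D F -> D G -> 0 <= lam <= 1 ->
     D (fun x => lam * F x + (1 - lam) * G x)) ->
  0 < C ->
  (forall F G, D F -> is_cdf_ab a b G ->
     ((`|T F - T G|)%:E <= C%:E * supnorm (fun x => (F x - G x)%R))%E) ->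
  D H1 -> D H2 ->
  (forall tau, 0 <= tau <= 1 -> D (Jmix H1 H2 tau)) ->
  0 < cminus ->
  (forall tau1 tau2, 0 <= tau1 -> tau1 <= tau2 -> tau2 <= 1 ->
     cminus * (tau2 - tau1) <= T (Jmix H1 H2 tau2) - T (Jmix H1 H2 tau1)) ->
  exists c : R, 0 < c /\
  forall (K : nat), (2 <= K)%N ->
  forall (M : set 'rV[R]_K), closed M -> M `<=` @simplex R K ->
    (exists d1 d2, [/\ M d1, M d2 & d1 != d2]) ->
  forall (pol : nat -> nat -> seq (R * R) -> R -> 'I_K)
         (rec : nat -> seq (R * R) -> R -> 'rV[R]_K),
    is_policy a b M pol rec ->
  forall (PG : probability R R) (n : nat), (K <= n)%N ->
    (c%:E * \big[maxe/-oo%E]_(P : {set {set 'I_K}} | finset.partition P [set: 'I_K]%SET)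
              (kappa M P * (Num.sqrt (#|P|%:R / n%:R))%:E)
     <= ereal_sup [set e | exists (tau : 'I_K -> R) (mu : 'I_K -> probability R R),
          [/\ (forall i, (0 <= tau i <= 1)%R),
              (forall i (x : R), mu i [set y : R | (y <= x)%R] = (Jmix H1 H2 (tau i) x)%:E) &
              e = exp_regret T M pol rec PG n (fun i => Jmix H1 H2 (tau i)) mu]])%E.
Proof.
move=> ab _ D_cdf _ _ _ DH1 DH2 DJ cminus0 T_growth.
have [nu1 nu1P] := probability_of_cdf (D_cdf _ DH1).
have [nu2 nu2P] := probability_of_cdf (D_cdf _ DH2).
(* The constant of [gap_lower_bound], which depends on [cminus] alone. *)
exists (cminus / 64); split; first by rewrite divr_gt0.
move=> K K2 M _ M_simplex [d0 [_ [Md0 _ _]]] pol rec policy PG n Kn.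
have K0 : (0 < K)%N := ltnW K2.
set S := ereal_sup _.
have S0 : (0 <= S)%E.
  exact: (sup_regret_ge0 T ab D_cdf DJ nu1P nu2P policy PG Kn Md0).
have c0 : 0 < cminus / 64 by rewrite divr_gt0.
rewrite -lee_pdivlMl//; apply: bigmax_le => [|P partP]; first exact: leNye.
have sq0 : 0 < Num.sqrt (#|P|%:R / n%:R) :> R.
  by rewrite sqrtr_gt0 divr_gt0 ?ltr0n ?(leq_trans K0 Kn)// (card_partition_gt0 partP).
rewrite -lee_pdivlMr//; apply: ge_ereal_sup => e [A [v [w [_ [v1 w1 eE]]]]].
(* The candidate [e] is an extended real while [gap_lower_bound] takes a real gap, so positive reals
   below [e] are treated first. A nonpositive [e] then follows from [S0], and an infinite one from
   arbitrarily large [r]. *)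
have bound r : 0 < r -> (r%:E <= e)%E ->
    (r%:E <= (cminus / 64)^-1%:E * S * (Num.sqrt (#|P|%:R / n%:R))^-1%:E)%E.
  move=> r0 re; rewrite lee_pdivlMr// lee_pdivlMl// -!EFinM [r * _]mulrC mulrA.
  move: re; rewrite eE le_min => /andP[gapA gapB].
  apply: (gap_lower_bound ab D_cdf DJ cminus0 T_growth nu1P nu2P M_simplex
    policy PG K0 Kn Md0 partP v1 w1 gapA) => // B PB.
  exact: le_trans gapB (bigmin_le_cond _ _ PB).
case: e {eE} bound => [r| |] bound; last exact: leNye.
  have [r0|r0] := leP r 0; last exact: bound.
  apply: (@le_trans _ _ 0%E); first by rewrite lee_fin.
  apply: mule_ge0; last by rewrite lee_fin invr_ge0 ltW.
  by apply: mule_ge0 => //; rewrite lee_fin invr_ge0 ltW.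
rewrite leye_eq; apply/eqP/eqyP => r r0; apply: bound => //; exact: leey.
Qed.
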